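(* Let $\nu,\mu>0$, let $(\rho,\tau)$ be a $G$-equivariant pair with $\tau$ smooth, let $\Gamma$ be a discrete subgroup of $G=\mathrm{U}(1)\ltimes\mathbb{C}$ with $\rho(\Gamma)\subset\Gamma$, let $\chi:\Gamma\to\mathrm{U}(1)$ be a map, and let $\lambda\in\mathbb{C}$. With $B$, $\varphi$, $\chi_\tau$, $\Delta^{\nu,\mu}_\tau$, $\Delta_B$, $\mathcal{M}^{\nu,\mu}_{\rho,\tau}(\mathbb{C})$ and $\mathcal{F}^{B}_{\Gamma,\chi_\tau}(\mathbb{C})$ as defined in the context, and $[\mathcal{W}f](z)=e^{i\varphi(z)}f(z)$, one has $$\mathcal{W}\Big(\{F\in\mathcal{M}^{\nu,\mu}_{\rho,\tau}(\mathbb{C}):\ \Delta^{\nu,\mu}_\tau F=\lambda F\}\Big)=\{F\in\mathcal{F}^{B}_{\Gamma,\chi_\tau}(\mathbb{C}):\ \Delta_BF=\lambda F\}.$$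
   Context: $G=\mathrm{U}(1)\ltimes\mathbb{C}$ is the group of pairs $[a,b]$ with $|a|=1$, $b\in\mathbb{C}$ and product $[a,b][a',b']=[aa',ab'+b]$, acting on $\mathbb{C}$ by $[a,b]\cdot z=az+b$. A pair $(\rho,\tau)$ is a $G$-equivariant pair if $\rho:G\to G$ is a group endomorphism and $\tau:\mathbb{C}\to\mathbb{C}$ is a map with $\tau(g\cdot z)=\rho(g)\cdot\tau(z)$ for all $g\in G$, $z\in\mathbb{C}$. Write $\langle z,w\rangle=z\overline{w}$ and $j^\alpha(g,z)=e^{-i\alpha\operatorname{Im}\langle z,g^{-1}\cdot0\rangle}$ for $\alpha\in\mathbb{R}$, $g\in G$, $z\in\mathbb{C}$. The function $B=\nu+\mu\left(\left|\frac{\partial\tau}{\partial z}\right|^2-\left|\frac{\partial\tau}{\partial\bar z}\right|^2\right)$ is a real constant on $\mathbb{C}$. Define $\theta^{\nu,\mu}_\tau=-\frac{\nu}{2}(\bar z\,dz-z\,d\bar z)-\frac{\mu}{2}(\bar\tau\,d\tau-\tau\,d\bar\tau)$ and $\theta_B=-\frac{B}{2}(\bar z\,dz-z\,d\bar z)$. The phase function $\varphi$ is a smooth real-valued function on $\mathbb{C}$ with $\theta^{\nu,\mu}_\tau=\theta_B+i\,d\varphi$ (it exists and is unique up to an additive real constant). For a smooth purely imaginary-valued 1-form $\theta$ on $\mathbb{C}$, set $H_\theta=(d+\operatorname{ext}\theta)^*(d+\operatorname{ext}\theta)$ acting on smooth functions, where $\operatorname{ext}\theta$ is left exterior multiplication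 by $\theta$ and $^*$ is the formal adjoint for the Hermitian $L^2$ products on functions and 1-forms induced by the Euclidean metric $dx^2+dy^2$. Put $\Delta^{\nu,\mu}_\tau=-H_{\theta^{\nu,\mu}_\tau}$ and $\Delta_B=-H_{\theta_B}=4\frac{\partial^2}{\partial z\partial\bar z}+2B\left(z\frac{\partial}{\partial z}-\bar z\frac{\partial}{\partial\bar z}\right)-B^2|z|^2$. $\mathcal{M}^{\nu,\mu}_{\rho,\tau}(\mathbb{C})$ is the space of $F\in\mathcal{C}^\infty(\mathbb{C})$ with $F(\gamma\cdot z)=\chi(\gamma)j^\nu(\gamma,z)j^\mu(\rho(\gamma),\tau(z))F(z)$ for all $\gamma\in\Gamma$, $z\in\mathbb{C}$. $\mathcal{F}^{B}_{\Gamma,\chi_\tau}(\mathbb{C})$ is the space of $F\in\mathcal{C}^\infty(\mathbb{C})$ with $F(\gamma\cdot z)=\chi_\tau(\gamma)j^{B}(\gamma,z)F(z)$ for all $\gamma\in\Gamma$, $z\in\mathbb{C}$, where $\chi_\tau(\gamma)=\chi(\gamma)\exp\big(i\varphi(\gamma\cdot0)-i\varphi(0)-i\mu\operatorname{Im}\langle\tau(0),\rho(\gamma)^{-1}\cdot0\rangle\big)$. *)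

(* Defs.v *)
From Stdlib Require Import Reals Lra ClassicalEpsilon.
From Coquelicot Require Import Coquelicot.

Open Scope R_scope.
Open Scope C_scope.

Record G : Type := mkG {
  rot : C;
  trans : C;
  rot_unit : Cmod rot = 1%R
}.

Definition act (g : G) (z : C) : C := rot g * z + trans g.

Lemma gmul_unit (g h : G) : Cmod (rot g * rot h) = 1%R.
Proof. rewrite Cmod_mult, (rot_unit g), (rot_unit h). apply Rmult_1_l. Qed.

Definition gmul (g h : G) : G :=
  mkG (rot g * rot h) (rot g * trans h + trans g) (gmul_unit g h).

Definition gone : G := mkG 1 0 Cmod_1.

Lemma ginv_unit (g : G) : Cmod (Cconj (rot g)) = 1%R.
Proof. rewrite Cmod_conj. apply rot_unit. Qed.

Definition ginv (g : G) : G :=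
  mkG (Cconj (rot g)) (- (Cconj (rot g) * trans g)) (ginv_unit g).

Definition is_endomorphism (rho : G -> G) : Prop :=
  forall g h : G, rho (gmul g h) = gmul (rho g) (rho h).

Definition equivariant_pair (rho : G -> G) (tau : C -> C) : Prop :=
  is_endomorphism rho /\
  forall (g : G) (z : C), tau (act g z) = act (rho g) (tau z).

Definition is_subgroup (Gamma : G -> Prop) : Prop :=
  Gamma gone /\
  (forall g h : G, Gamma g -> Gamma h -> Gamma (gmul g h)) /\
  (forall g : G, Gamma g -> Gamma (ginv g)).

(* Every point is isolated, for the topology of [G] as a subspace of [C * C]. *)
Definition is_discrete (Gamma : G -> Prop) : Prop :=
  forall g : G, Gamma g ->
  exists eps : posreal, forall h : G, Gamma h ->
    Cmod (rot h - rot g) < eps -> Cmod (trans h - trans g) < eps -> h = g.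

Definition is_discrete_subgroup (Gamma : G -> Prop) : Prop :=
  is_subgroup Gamma /\ is_discrete Gamma.

Definition herm (z w : C) : C := z * Cconj w.

(* [cis t] is exp(i t). *)
Definition cis (t : R) : C := (cos t, sin t).

Definition j (alpha : R) (g : G) (z : C) : C :=
  cis (- (alpha * Im (herm z (act (ginv g) 0)))).

(* [ex_diff_n u n x y]: all partial derivatives of [u] of order at most [n]
   exist and are continuous at (x, y). *)
Definition smooth_real (u : C -> R) : Prop :=
  forall (n : nat) (x y : R), ex_diff_n (fun s t => u (s, t)) n x y.

Definition smooth (f : C -> C) : Prop :=
  smooth_real (fun z => Re (f z)) /\ smooth_real (fun z => Im (f z)).

Definition partial_x (f : C -> C) (z : C) : C :=
  (Derive (fun t => Re (f (t, Im z))) (Re z),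
   Derive (fun t => Im (f (t, Im z))) (Re z)).

Definition partial_y (f : C -> C) (z : C) : C :=
  (Derive (fun t => Re (f (Re z, t))) (Im z),
   Derive (fun t => Im (f (Re z, t))) (Im z)).

Definition partial_z (f : C -> C) (z : C) : C :=
  (partial_x f z - Ci * partial_y f z) / 2.

Definition partial_zbar (f : C -> C) (z : C) : C :=
  (partial_x f z + Ci * partial_y f z) / 2.

(* A 1-form P dx + Q dy is given by its coefficients (P, Q), which are its
   components in an orthonormal coframe for dx^2 + dy^2. *)
Definition form1 : Type := C -> C * C.

Definition smooth_form (w : form1) : Prop :=
  smooth (fun z => fst (w z)) /\ smooth (fun z => snd (w z)).

Definition form_add (w w' : form1) : form1 :=
  fun z => (fst (w z) + fst (w' z), snd (w z) + snd (w' z)).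

Definition form_mul (f : C -> C) (w : form1) : form1 :=
  fun z => (f z * fst (w z), f z * snd (w z)).

Definition diff (f : C -> C) : form1 :=
  fun z => (partial_x f z, partial_y f z).

(* -(c/2) (conj(f) df - f d(conj(f))). *)
Definition theta_of (c : R) (f : C -> C) : form1 :=
  form_mul (fun _ => - (RtoC c / 2))
    (form_add (form_mul (fun z => Cconj (f z)) (diff f))
              (form_mul (fun z => - f z) (diff (fun z => Cconj (f z))))).

Definition theta_mixed (nu mu : R) (tau : C -> C) : form1 :=
  form_add (theta_of nu (fun z => z)) (theta_of mu tau).

Definition theta_B (B : R) : form1 := theta_of B (fun z => z).

Definition int_line (u : R -> R) : R :=
  RInt_gen u (Rbar_locally m_infty) (Rbar_locally p_infty).

Definition int_plane (u : C -> R) : R :=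
  int_line (fun x => int_line (fun y => u (x, y))).

Definition Cint_plane (f : C -> C) : C :=
  (int_plane (fun z => Re (f z)), int_plane (fun z => Im (f z))).

Definition L2_fun (f g : C -> C) : C :=
  Cint_plane (fun z => f z * Cconj (g z)).

Definition L2_form (w w' : form1) : C :=
  Cint_plane (fun z => fst (w z) * Cconj (fst (w' z))
                     + snd (w z) * Cconj (snd (w' z))).

Definition compact_support (f : C -> C) : Prop :=
  exists M : R, forall z : C, M < Cmod z -> f z = 0.

Definition is_formal_adjoint
    (A : (C -> C) -> form1) (Astar : form1 -> C -> C) : Prop :=
  forall w : form1, smooth_form w ->
    smooth (Astar w) /\
    forall f : C -> C, smooth f -> compact_support f ->
      L2_form (A f) w = L2_fun f (Astar w).

(* The defining property determines the values on smooth forms, the only ones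
   used below. *)
Definition formal_adjoint (A : (C -> C) -> form1) : form1 -> C -> C :=
  epsilon (inhabits (fun _ _ => RtoC 0)) (is_formal_adjoint A).

(* d + ext theta on functions. *)
Definition nabla (theta : form1) (f : C -> C) : form1 :=
  form_add (diff f) (form_mul f theta).

Definition H (theta : form1) (f : C -> C) : C -> C :=
  formal_adjoint (nabla theta) (nabla theta f).

Definition Delta_mixed (nu mu : R) (tau : C -> C) (f : C -> C) (z : C) : C :=
  - H (theta_mixed nu mu tau) f z.

Definition Delta_B (B : R) (f : C -> C) (z : C) : C :=
  - H (theta_B B) f z.

Definition B_fun (nu mu : R) (tau : C -> C) (z : C) : R :=
  nu + mu * (Cmod (partial_z tau z) ^ 2 - Cmod (partial_zbar tau z) ^ 2).

(* [B_fun] does not depend on the point, see [B_fun_const]. *)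
Definition B_const (nu mu : R) (tau : C -> C) : R := B_fun nu mu tau 0.

Lemma partial_x_affine (f : C -> C) (a b c : C) :
  smooth f -> (forall z, f (z + c) = a * f z + b) ->
  partial_x f c = a * partial_x f 0.
Proof.
  intros [hr hi] h.
  destruct (hr 1%nat 0 0) as [_ [dr _]], (hi 1%nat 0 0) as [_ [di _]].
  cbn beta in dr, di.
  assert (sh : forall u : R -> R,
    Derive u (Re c) = Derive (fun t => u (t + Re c)%R) 0).
  { intros u.
    pose proof (Derive_n_comp_trans u 1 0 (Re c)) as e.
    simpl in e. rewrite e, Rplus_0_l. reflexivity. }
  unfold partial_x. rewrite !sh.
  assert (E : forall t, f ((t + Re c)%R, Im c) = a * f (t, 0%R) + b).
  { intros t. rewrite <- h. unfold Cplus. simpl. now rewrite Rplus_0_l. }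
  destruct a as [a1 a2], b as [b1 b2].
  rewrite (Derive_ext _ (fun t => a1 * Re (f (t, 0)) - a2 * Im (f (t, 0)) + b1)%R).
  2:{ intros t. rewrite E. unfold Re, Im, Cplus, Cmult; simpl. ring. }
  rewrite (Derive_ext (fun t => Im (f ((t + Re c)%R, Im c)))
    (fun t => a1 * Im (f (t, 0)) + a2 * Re (f (t, 0)) + b2)%R).
  2:{ intros t. rewrite E. unfold Re, Im, Cplus, Cmult; simpl. ring. }
  unfold Cmult; simpl.
  set (u := fun t : R => Re (f (t, 0))) in *.
  set (v := fun t : R => Im (f (t, 0))) in *.
  change (ex_derive u 0) in dr. change (ex_derive v 0) in di.
  f_equal; apply is_derive_unique.
  - change (is_derive (fun t => a1 * u t - a2 * v t + b1)%R 0
      (a1 * Derive u 0 - a2 * Derive v 0)%R).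
    clearbody u v. auto_derive; [tauto |].
    change (fun x : R => u x) with u; change (fun x : R => v x) with v; ring.
  - change (is_derive (fun t => a1 * v t + a2 * u t + b2)%R 0
      (a1 * Derive v 0 + a2 * Derive u 0)%R).
    clearbody u v. auto_derive; [tauto |].
    change (fun x : R => u x) with u; change (fun x : R => v x) with v; ring.
Qed.

Lemma partial_y_affine (f : C -> C) (a b c : C) :
  smooth f -> (forall z, f (z + c) = a * f z + b) ->
  partial_y f c = a * partial_y f 0.
Proof.
  intros [hr hi] h.
  destruct (hr 1%nat 0 0) as [_ [_ [dr _]]], (hi 1%nat 0 0) as [_ [_ [di _]]].
  cbn beta in dr, di.
  assert (sh : forall u : R -> R,
    Derive u (Im c) = Derive (fun t => u (t + Im c)%R) 0).
  { intros u.
    pose proof (Derive_n_comp_trans u 1 0 (Im c)) as e.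
    simpl in e. rewrite e, Rplus_0_l. reflexivity. }
  unfold partial_y. rewrite !sh.
  assert (E : forall t, f (Re c, (t + Im c)%R) = a * f (0%R, t) + b).
  { intros t. rewrite <- h. unfold Cplus. simpl. now rewrite Rplus_0_l. }
  destruct a as [a1 a2], b as [b1 b2].
  rewrite (Derive_ext _ (fun t => a1 * Re (f (0, t)) - a2 * Im (f (0, t)) + b1)%R).
  2:{ intros t. rewrite E. unfold Re, Im, Cplus, Cmult; simpl. ring. }
  rewrite (Derive_ext (fun t => Im (f (Re c, (t + Im c)%R)))
    (fun t => a1 * Im (f (0, t)) + a2 * Re (f (0, t)) + b2)%R).
  2:{ intros t. rewrite E. unfold Re, Im, Cplus, Cmult; simpl. ring. }
  unfold Cmult; simpl.
  set (u := fun t : R => Re (f (0, t))) in *.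
  set (v := fun t : R => Im (f (0, t))) in *.
  change (ex_derive u 0) in dr. change (ex_derive v 0) in di.
  f_equal; apply is_derive_unique.
  - change (is_derive (fun t => a1 * u t - a2 * v t + b1)%R 0
      (a1 * Derive u 0 - a2 * Derive v 0)%R).
    clearbody u v. auto_derive; [tauto |].
    change (fun x : R => u x) with u; change (fun x : R => v x) with v; ring.
  - change (is_derive (fun t => a1 * v t + a2 * u t + b2)%R 0
      (a1 * Derive v 0 + a2 * Derive u 0)%R).
    clearbody u v. auto_derive; [tauto |].
    change (fun x : R => u x) with u; change (fun x : R => v x) with v; ring.
Qed.

Lemma B_fun_const (nu mu : R) (rho : G -> G) (tau : C -> C) :
  equivariant_pair rho tau -> smooth tau ->
  forall z : C, B_fun nu mu tau z = B_const nu mu tau.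
Proof.
  intros [_ h] st c.
  set (g := mkG 1 c Cmod_1).
  assert (hc : forall z, tau (z + c) = rot (rho g) * tau z + trans (rho g)).
  { intros z. change (tau (z + c) = act (rho g) (tau z)). rewrite <- h.
    f_equal. unfold act; simpl. ring. }
  assert (X := partial_x_affine tau _ _ _ st hc).
  assert (Y := partial_y_affine tau _ _ _ st hc).
  unfold B_const, B_fun, partial_z, partial_zbar.
  rewrite X, Y.
  set (p := partial_x tau 0). set (q := partial_y tau 0). set (r := rot (rho g)).
  replace ((r * p - Ci * (r * q)) / 2) with (r * ((p - Ci * q) / 2))
    by (unfold Cdiv; ring).
  replace ((r * p + Ci * (r * q)) / 2) with (r * ((p + Ci * q) / 2))
    by (unfold Cdiv; ring).
  rewrite !Cmod_mult. unfold r. rewrite (rot_unit (rho g)), !Rmult_1_l.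
  reflexivity.
Qed.

Definition is_phase (nu mu : R) (tau : C -> C) (phi : C -> R) : Prop :=
  smooth_real phi /\
  forall z : C,
    theta_mixed nu mu tau z =
    form_add (theta_B (B_const nu mu tau))
             (form_mul (fun _ => Ci) (diff (fun w => RtoC (phi w)))) z.

Definition mixed_automorphic (nu mu : R) (rho : G -> G) (tau : C -> C)
    (Gamma : G -> Prop) (chi : G -> C) (F : C -> C) : Prop :=
  smooth F /\
  forall (g : G) (z : C), Gamma g ->
    F (act g z) = chi g * j nu g z * j mu (rho g) (tau z) * F z.

Definition automorphic (B : R) (Gamma : G -> Prop) (chi : G -> C)
    (F : C -> C) : Prop :=
  smooth F /\
  forall (g : G) (z : C), Gamma g -> F (act g z) = chi g * j B g z * F z.

Definition chi_tau (mu : R) (rho : G -> G) (tau : C -> C) (phi : C -> R)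
    (chi : G -> C) (g : G) : C :=
  chi g * cis (phi (act g 0) - phi 0
               - mu * Im (herm (tau 0) (act (ginv (rho g)) 0)))%R.

Definition W (phi : C -> R) (f : C -> C) (z : C) : C := cis (phi z) * f z.

Definition image (T : (C -> C) -> C -> C) (S : (C -> C) -> Prop)
    (F : C -> C) : Prop :=
  exists f : C -> C, S f /\ F = T f.

(* Main.v *)
(* With [B] constant, the phase identity says that multiplication by
   [cis phi] intertwines [d + ext theta_mixed] and [d + ext theta_B], hence also
   their adjoints and the two Laplacians. The adjoint exists by integration by
   parts; it is unique on smooth forms by testing against a bump function built
   from exp(-1/x).

   For the automorphy conditions, [i d phi = theta_mixed - theta_B] and the
   equivariance of [tau] show that the difference of the two automorphy
   exponents has zero differential, hence equals its value at [0], which is the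
   exponent in [chi_tau]. *)

From Stdlib Require Import Reals Lra Arith Factorial ClassicalEpsilon FunctionalExtensionality.
From Coquelicot Require Import Coquelicot.
Require Import Defs.

Open Scope R_scope.

(** * Smooth real functions on the plane *)

(** [formal_adjoint] is picked by [epsilon], so it has no formula: a candidate must be exhibited
    before it has any property, and afterwards it can be reached only through its pairing with test
    functions. Intertwining passes to adjoints because [cis phi] has modulus 1: multiplication by it
    preserves both L2 products and permutes the test functions. The plane integral is an iterated
    improper one; compact support reduces it to a fixed square, and x-derivatives are pulled out of
    the inner integral, which avoids exchanging the order of integration. On the automorphic side,
    the form Im(conj(z) dz) is not invariant under g: its pullback differs from it by the
    differential of -Im<z, g^-1 0>, which is where the exponent of [j] comes from. Applied to g at z
    and to rho(g) at tau(z), this gives the two automorphy exponents. *)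

Definition dx (u : C -> R) (z : C) : R := Derive (fun t => u (t, Im z)) (Re z).
Definition dy (u : C -> R) (z : C) : R := Derive (fun t => u (Re z, t)) (Im z).

(** [ex_diff_n] with the quantifier over points moved inside the recursion. The product and chain
    rules can then be used as equalities between functions, which require the derivatives to exist
    at every point and not only at the one considered. *)
Fixpoint C_n (n : nat) (u : C -> R) : Prop :=
  (forall x y, continuity_2d_pt (fun s t => u (s, t)) x y) /\
  match n with
  | O => True
  | S m => (forall x y, ex_derive (fun t => u (t, y)) x) /\
           (forall x y, ex_derive (fun t => u (x, t)) y) /\
           C_n m (dx u) /\ C_n m (dy u)
  end.

Lemma C_n_ex_diff (n : nat) (u : C -> R) :
  C_n n u <-> forall x y, ex_diff_n (fun s t => u (s, t)) n x y.
Proof.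
  revert u; induction n as [| n IH]; intros u; simpl.
  - split.
    + intros [h _] x y. split; [apply h | exact I].
    + intros h. split; [intros x y; apply h | exact I].
  - rewrite !IH. split.
    + intros [hc [hx [hy [hdx hdy]]]] x y.
      split; [apply hc | split; [apply hx | split; [apply hy |]]].
      split; [apply hdx | apply hdy].
    + intros h. repeat split; intros x y; now destruct (h x y) as [? [? [? [? ?]]]].
Qed.

Lemma smooth_real_C_n (u : C -> R) : smooth_real u <-> forall n, C_n n u.
Proof.
  split.
  - intros h n. apply C_n_ex_diff. intros x y. apply h.
  - intros h n x y. now apply C_n_ex_diff.
Qed.

Lemma C_n_pred (n : nat) (u : C -> R) : C_n (S n) u -> C_n n u.
Proof.
  revert u; induction n as [| n IH]; intros u h.
  - split; [apply h | exact I].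
  - destruct h as [hc [hx [hy [hdx hdy]]]].
    split; [exact hc | split; [exact hx | split; [exact hy |]]].
    split; apply IH; assumption.
Qed.

Lemma smooth_real_continuity (u : C -> R) (x y : R) :
  smooth_real u -> continuity_2d_pt (fun s t => u (s, t)) x y.
Proof. intros h. exact (proj1 (h 0%nat x y)). Qed.

Lemma smooth_real_ex_derive_x (u : C -> R) (x y : R) :
  smooth_real u -> ex_derive (fun t => u (t, y)) x.
Proof. intros h. apply (h 1%nat x y). Qed.

Lemma smooth_real_ex_derive_y (u : C -> R) (x y : R) :
  smooth_real u -> ex_derive (fun t => u (x, t)) y.
Proof. intros h. apply (h 1%nat x y). Qed.

Lemma smooth_real_dx (u : C -> R) : smooth_real u -> smooth_real (dx u).
Proof.
  rewrite !smooth_real_C_n. intros h n. apply (h (S n)).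
Qed.

Lemma smooth_real_dy (u : C -> R) : smooth_real u -> smooth_real (dy u).
Proof.
  rewrite !smooth_real_C_n. intros h n. apply (h (S n)).
Qed.

Lemma C_n_const (n : nat) (c : R) : C_n n (fun _ => c).
Proof.
  revert c; induction n as [| n IH]; intros c.
  - split; [intros; apply continuity_2d_pt_const | exact I].
  - split; [intros; apply continuity_2d_pt_const |].
    split; [intros x y; apply (ex_derive_const c x) |].
    split; [intros x y; apply (ex_derive_const c y) |].
    split.
    + replace (dx (fun _ => c)) with (fun _ : C => 0); [apply IH |].
      apply functional_extensionality; intros z; unfold dx. now rewrite Derive_const.
    + replace (dy (fun _ => c)) with (fun _ : C => 0); [apply IH |].
      apply functional_extensionality; intros z; unfold dy. now rewrite Derive_const.
Qed.

Lemma smooth_real_const (c : R) : smooth_real (fun _ => c).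
Proof. apply smooth_real_C_n. intros n; apply C_n_const. Qed.

Lemma smooth_real_Re : smooth_real Re.
Proof.
  apply smooth_real_C_n. intros [| n].
  - split; [intros; apply continuity_2d_pt_id1 | exact I].
  - split; [intros; apply continuity_2d_pt_id1 |].
    split; [intros x y; apply (ex_derive_id x) |].
    split; [intros x y; apply (ex_derive_const x y) |].
    split.
    + replace (dx Re) with (fun _ : C => 1); [apply C_n_const |].
      apply functional_extensionality; intros z. unfold dx; simpl. now rewrite Derive_id.
    + replace (dy Re) with (fun _ : C => 0); [apply C_n_const |].
      apply functional_extensionality; intros z. unfold dy; simpl. now rewrite Derive_const.
Qed.

Lemma smooth_real_Im : smooth_real Im.
Proof.
  apply smooth_real_C_n. intros [| n].
  - split; [intros; apply continuity_2d_pt_id2 | exact I].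
  - split; [intros; apply continuity_2d_pt_id2 |].
    split; [intros x y; apply (ex_derive_const y x) |].
    split; [intros x y; apply (ex_derive_id y) |].
    split.
    + replace (dx Im) with (fun _ : C => 0); [apply C_n_const |].
      apply functional_extensionality; intros z. unfold dx; simpl. now rewrite Derive_const.
    + replace (dy Im) with (fun _ : C => 1); [apply C_n_const |].
      apply functional_extensionality; intros z. unfold dy; simpl. now rewrite Derive_id.
Qed.

Lemma C_n_plus (n : nat) (u v : C -> R) :
  C_n n u -> C_n n v -> C_n n (fun z => u z + v z).
Proof.
  revert u v; induction n as [| n IH]; intros u v hu hv.
  - split; [intros; apply continuity_2d_pt_plus; [apply hu | apply hv] | exact I].
  - destruct hu as [uc [ux [uy [udx udy]]]], hv as [vc [vx [vy [vdx vdy]]]].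
    split; [intros; now apply continuity_2d_pt_plus |].
    split; [intros; apply @ex_derive_plus; auto |].
    split; [intros; apply @ex_derive_plus; auto |].
    split.
    + replace (dx _) with (fun z => dx u z + dx v z); [now apply IH |].
      apply functional_extensionality; intros z. symmetry.
      apply (Derive_plus (fun t => u (t, Im z)) (fun t => v (t, Im z))); auto.
    + replace (dy _) with (fun z => dy u z + dy v z); [now apply IH |].
      apply functional_extensionality; intros z. symmetry.
      apply (Derive_plus (fun t => u (Re z, t)) (fun t => v (Re z, t))); auto.
Qed.

Lemma C_n_mult (n : nat) (u v : C -> R) :
  C_n n u -> C_n n v -> C_n n (fun z => u z * v z).
Proof.
  revert u v; induction n as [| n IH]; intros u v hu hv.
  - split; [intros; apply continuity_2d_pt_mult; [apply hu | apply hv] | exact I].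
  (* Each term of the product rule pairs a derivative, of class n, with an undifferentiated factor,
     which must be lowered to class n for the induction hypothesis. *)
  - assert (hu' := C_n_pred _ _ hu). assert (hv' := C_n_pred _ _ hv).
    destruct hu as [uc [ux [uy [udx udy]]]], hv as [vc [vx [vy [vdx vdy]]]].
    split; [intros; now apply continuity_2d_pt_mult |].
    split; [intros; apply ex_derive_mult; auto |].
    split; [intros; apply ex_derive_mult; auto |].
    split.
    + replace (dx _) with (fun z => dx u z * v z + u z * dx v z).
      { now apply (C_n_plus n (fun z => dx u z * v z) (fun z => u z * dx v z)); apply IH. }
      apply functional_extensionality; intros [x y]. symmetry.
      apply (Derive_mult (fun t => u (t, y)) (fun t => v (t, y))); auto.
    + replace (dy _) with (fun z => dy u z * v z + u z * dy v z).
      { now apply (C_n_plus n (fun z => dy u z * v z) (fun z => u z * dy v z)); apply IH. }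
      apply functional_extensionality; intros [x y]. symmetry.
      apply (Derive_mult (fun t => u (x, t)) (fun t => v (x, t))); auto.
Qed.

(** One step of the chain rule: a family of one-variable functions closed under differentiation up
    to linear combinations can be treated by one induction. It serves for cos and sin, and for the
    functions [flat k]. *)
Lemma C_n_comp (n : nat) (h : R -> R) (u : C -> R) :
  (forall s, ex_derive h s) -> C_n (S n) u ->
  C_n n (fun z => Derive h (u z)) -> C_n (S n) (fun z => h (u z)).
Proof.
  intros hd hu hh.
  assert (hu' := C_n_pred _ _ hu).
  destruct hu as [uc [ux [uy [udx udy]]]].
  split.
  { intros x y. apply (continuity_1d_2d_pt_comp h (fun s t => u (s, t))); [| apply uc].
    apply continuity_pt_filterlim, @ex_derive_continuous, hd. }
  split; [intros x y; apply (ex_derive_comp h (fun t => u (t, y))); auto |].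
  split; [intros x y; apply (ex_derive_comp h (fun t => u (x, t))); auto |].
  split.
  - replace (dx _) with (fun z => dx u z * Derive h (u z)); [now apply C_n_mult |].
    apply functional_extensionality; intros [x y]. symmetry.
    apply (Derive_comp h (fun t => u (t, y))); auto.
  - replace (dy _) with (fun z => dy u z * Derive h (u z)); [now apply C_n_mult |].
    apply functional_extensionality; intros [x y]. symmetry.
    apply (Derive_comp h (fun t => u (x, t))); auto.
Qed.

Lemma smooth_real_plus (u v : C -> R) :
  smooth_real u -> smooth_real v -> smooth_real (fun z => u z + v z).
Proof. rewrite !smooth_real_C_n. intros; now apply C_n_plus. Qed.

Lemma smooth_real_mult (u v : C -> R) :
  smooth_real u -> smooth_real v -> smooth_real (fun z => u z * v z).
Proof. rewrite !smooth_real_C_n. intros; now apply C_n_mult. Qed.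

Lemma smooth_real_ext (u v : C -> R) :
  (forall z, u z = v z) -> smooth_real u -> smooth_real v.
Proof. intros e. now rewrite (functional_extensionality _ _ e). Qed.

Lemma smooth_real_opp (u : C -> R) :
  smooth_real u -> smooth_real (fun z => - u z).
Proof.
  intros h. apply smooth_real_ext with (fun z => -1 * u z); [intros; ring |].
  apply smooth_real_mult; [apply smooth_real_const | exact h].
Qed.

Lemma smooth_real_minus (u v : C -> R) :
  smooth_real u -> smooth_real v -> smooth_real (fun z => u z - v z).
Proof.
  intros hu hv. apply smooth_real_plus; [exact hu | now apply smooth_real_opp].
Qed.

Lemma smooth_real_cos_sin (u : C -> R) :
  smooth_real u ->
  smooth_real (fun z => cos (u z)) /\ smooth_real (fun z => sin (u z)).
Proof.
  intros hu. pose proof (proj1 (smooth_real_C_n u) hu) as hn.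
  assert (ec : forall s, ex_derive cos s)
    by (intros s; eexists; apply is_derive_cos).
  assert (es : forall s, ex_derive sin s)
    by (intros s; eexists; apply is_derive_sin).
  (* Each function is, up to sign, the derivative of the other, so the two inductions run
     together. *)
  assert (K : forall n, C_n n (fun z => cos (u z)) /\ C_n n (fun z => sin (u z))).
  { intros n. induction n as [| n [IHc IHs]].
    - split; split; trivial; intros x y;
        [apply (continuity_1d_2d_pt_comp cos (fun s t => u (s, t)))
        |apply (continuity_1d_2d_pt_comp sin (fun s t => u (s, t)))];
        try apply (hn O).
      + apply continuity_pt_filterlim, @ex_derive_continuous, ec.
      + apply continuity_pt_filterlim, @ex_derive_continuous, es.
    - split; apply C_n_comp; auto.
      + replace (fun z => Derive cos (u z)) with (fun z => -1 * sin (u z)).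
        { apply C_n_mult; [apply C_n_const | exact IHs]. }
        apply functional_extensionality; intros z.
        rewrite (is_derive_unique _ _ _ (is_derive_cos (u z))). ring.
      + replace (fun z => Derive sin (u z)) with (fun z => cos (u z)); [exact IHc |].
        apply functional_extensionality; intros z.
        now rewrite (is_derive_unique _ _ _ (is_derive_sin (u z))). }
  split; apply smooth_real_C_n; intros n; apply K.
Qed.

(** * A smooth bump function *)

(* [flat 0] is exp(-1/x) extended by 0; the powers of 1/x close the family
   under differentiation up to linear combinations. *)
Definition flat (k : nat) (x : R) : R :=
  if Rlt_dec 0 x then exp (- / x) * (/ x) ^ k else 0.

Lemma flat_pos (k : nat) (x : R) : 0 < x -> 0 < flat k x.
Proof.
  intros h. unfold flat. destruct (Rlt_dec 0 x); [| lra].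
  apply Rmult_lt_0_compat; [apply exp_pos | apply pow_lt, Rinv_0_lt_compat, h].
Qed.

Lemma flat_eq0 (k : nat) (x : R) : x <= 0 -> flat k x = 0.
Proof. intros h. unfold flat. destruct (Rlt_dec 0 x); [lra | reflexivity]. Qed.

(** For x > 0, keeping only the term of degree k + 2 in the exponential series of 1/x gives the
    bound. The two extra powers leave x^2, enough for the difference quotient at 0 to tend to 0. *)
Lemma flat_quadratic (k : nat) (x : R) :
  Rabs (flat k x) <= INR (fact (k + 2)) * x ^ 2.
Proof.
  assert (hf : 0 < INR (fact (k + 2))) by apply INR_fact_lt_0.
  destruct (Rlt_dec 0 x) as [h | h].
  2:{ rewrite flat_eq0, Rabs_R0 by lra. apply Rmult_le_pos; [lra | apply pow2_ge_0]. }
  rewrite Rabs_pos_eq by now apply Rlt_le, flat_pos.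
  unfold flat. destruct (Rlt_dec 0 x); [| lra].
  assert (hy : 0 < / x) by now apply Rinv_0_lt_compat.
  assert (T : (/ x) ^ (k + 2) / INR (fact (k + 2)) <= exp (/ x)).
  { eapply Rle_trans; [| apply (exp_ge_taylor (/ x) (k + 2)); lra].
    rewrite (Nat.add_comm k 2). change (2 + k)%nat with (S (S k)). rewrite tech5.
    assert (0 <= sum_f_R0 (fun i => (/ x) ^ i / INR (fact i)) (S k)); [| lra].
    apply cond_pos_sum. intros i. apply Rlt_le, Rdiv_lt_0_compat;
      [now apply pow_lt | apply INR_fact_lt_0]. }
  rewrite exp_Ropp.
  assert (he := exp_pos (/ x)).
  apply (Rmult_le_reg_l (exp (/ x) * (/ x) ^ 2)).
  { apply Rmult_lt_0_compat; [exact he | now apply pow_lt]. }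
  replace (exp (/ x) * (/ x) ^ 2 * (/ exp (/ x) * (/ x) ^ k))
    with ((/ x) ^ (k + 2)) by (rewrite pow_add; field; split; lra).
  replace (exp (/ x) * (/ x) ^ 2 * (INR (fact (k + 2)) * x ^ 2))
    with (INR (fact (k + 2)) * exp (/ x)) by (field; lra).
  apply (Rmult_le_reg_r (/ INR (fact (k + 2)))); [now apply Rinv_0_lt_compat |].
  replace (INR (fact (k + 2)) * exp (/ x) * / INR (fact (k + 2)))
    with (exp (/ x)) by (field; lra).
  exact T.
Qed.

Lemma is_derive_flat (k : nat) (x : R) :
  is_derive (flat k) x (flat (k + 2) x - INR k * flat (k + 1) x).
Proof.
  destruct (Rtotal_order x 0) as [h | [-> | h]].
  - rewrite !flat_eq0 by lra.
    apply is_derive_ext_loc with (fun _ => 0).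
    + apply (filter_imp (fun t => t < 0)).
      * intros t ht. symmetry. apply flat_eq0. lra.
      * now apply open_lt.
    + replace (0 - INR k * 0) with 0 by ring. apply @is_derive_const.
  - rewrite !flat_eq0 by lra. replace (0 - INR k * 0) with 0 by ring.
    apply is_derive_Reals. intros eps heps.
    set (c := INR (fact (k + 2))).
    assert (hc : 0 < c) by apply INR_fact_lt_0.
    (* By [flat_quadratic] the difference quotient at 0 is at most c |h|, whence this radius. *)
    assert (hd : 0 < eps / c) by now apply Rdiv_lt_0_compat.
    exists (mkposreal _ hd). intros h h0 hlt. simpl in hlt.
    rewrite Rplus_0_l, (flat_eq0 k 0) by lra.
    replace ((flat k h - 0) / h - 0) with (flat k h * / h) by (field; exact h0).
    rewrite Rabs_mult, Rabs_inv.
    assert (ha : 0 < Rabs h) by now apply Rabs_pos_lt.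
    apply Rle_lt_trans with (c * Rabs h).
    + apply (Rmult_le_reg_r (Rabs h)); [exact ha |].
      rewrite Rmult_assoc, Rinv_l, Rmult_1_r by lra.
      eapply Rle_trans; [apply flat_quadratic |].
      rewrite <- (pow2_abs h). unfold c. lra.
    + apply (Rmult_lt_compat_l c) in hlt; [| exact hc].
      now replace (c * (eps / c)) with eps in hlt by (field; lra).
  - apply is_derive_ext_loc with (fun t => exp (- / t) * (/ t) ^ k).
    + apply (filter_imp (fun t => 0 < t)).
      * intros t ht. unfold flat. destruct (Rlt_dec 0 t); [reflexivity | lra].
      * now apply open_gt.
    + unfold flat. destruct (Rlt_dec 0 x); [| lra].
      auto_derive; [lra |].
      (* Differentiating the power leaves the exponent [pred k]; the case split removes it. *)
      destruct k as [| k]; simpl pred.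
      * simpl. field. lra.
      * rewrite !pow_add. simpl pow. field. lra.
Qed.

Lemma smooth_real_flat (k : nat) (u : C -> R) :
  smooth_real u -> smooth_real (fun z => flat k (u z)).
Proof.
  intros hu. pose proof (proj1 (smooth_real_C_n u) hu) as hn.
  (* The index stays general because differentiation raises it by 1 or 2. *)
  apply smooth_real_C_n. intros n. revert k.
  induction n as [| n IH]; intros k.
  - split; [| exact I]. intros x y.
    apply (continuity_1d_2d_pt_comp (flat k) (fun s t => u (s, t))); [| apply (hn O)].
    apply continuity_pt_filterlim, @ex_derive_continuous.
    eexists; apply is_derive_flat.
  - apply C_n_comp; [intros s; eexists; apply is_derive_flat | apply hn |].
    replace (fun z => Derive (flat k) (u z))
      with (fun z => flat (k + 2) (u z) + - INR k * flat (k + 1) (u z)).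
    + apply C_n_plus; [apply IH |]. apply C_n_mult; [apply C_n_const | apply IH].
    + apply functional_extensionality; intros z.
      rewrite (is_derive_unique _ _ _ (is_derive_flat k (u z))). ring.
Qed.

Lemma Cmod_sqr (z : C) : Cmod z * Cmod z = Re z * Re z + Im z * Im z.
Proof.
  unfold Cmod. rewrite sqrt_sqrt; unfold Re, Im; [ring | nra].
Qed.

Lemma smooth_bump (r : R) :
  0 < r -> exists b : C -> R, smooth_real b /\
    (forall z, Cmod z < r -> 0 < b z) /\ (forall z, r <= Cmod z -> b z = 0).
Proof.
  (* The argument is r^2 - |z|^2, a polynomial in the coordinates, since |z| itself is not smooth at
     the origin. *)
  intros hr. exists (fun z => flat 0 (r * r - (Re z * Re z + Im z * Im z))).
  split; [| split].
  - apply smooth_real_flat, smooth_real_minus; [apply smooth_real_const |].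
    apply smooth_real_plus; apply smooth_real_mult;
      first [apply smooth_real_Re | apply smooth_real_Im].
  - intros z hz. apply flat_pos. rewrite <- Cmod_sqr.
    pose proof (Cmod_ge_0 z). nra.
  - intros z hz. apply flat_eq0. rewrite <- Cmod_sqr. nra.
Qed.

(** * Integrals of compactly supported functions *)

Lemma smooth_real_continuous_y (u : C -> R) (x y : R) :
  smooth_real u -> continuous (fun t => u (x, t)) y.
Proof. intros h. now apply @ex_derive_continuous, smooth_real_ex_derive_y. Qed.

(** A square rather than a disc, so that both integrations of the iterated integral have the same
    fixed bounds. *)
Definition box_supported (M : R) (u : C -> R) : Prop :=
  forall x y : R, M < Rabs x \/ M < Rabs y -> u (x, y) = 0.

Lemma is_RInt_zero (a b : R) : is_RInt (fun _ => 0) a b 0.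
Proof.
  exact (eq_ind _ (is_RInt (fun _ => 0) a b)
    (is_RInt_const a b (0 : R_NormedModule)) 0 (Rmult_0_r (b - a))).
Qed.

(** Once the endpoints lie beyond -M and M, the two outer pieces integrate to 0, so the integrals
    whose limit is taken are eventually constant. *)
Lemma int_line_compact (u : R -> R) (M : R) :
  0 <= M -> (forall x, continuous u x) ->
  (forall x, M < Rabs x -> u x = 0) -> int_line u = RInt u (- M) M.
Proof.
  intros hM hc h0. unfold int_line.
  apply is_RInt_gen_unique. intros P HP.
  exists (fun a => a < - M) (fun b => M < b).
  - exists (- M). tauto.
  - exists M. tauto.
  - intros a b ha hb. simpl. exists (RInt u (- M) M). split; [| now apply locally_singleton].
    assert (z1 : is_RInt u a (- M) 0).
    { apply is_RInt_ext with (fun _ => 0).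
      - intros x. rewrite Rmin_left, Rmax_right by lra. intros hx. symmetry.
        apply h0. rewrite Rabs_left; lra.
      - apply is_RInt_zero. }
    assert (z2 : is_RInt u M b 0).
    { apply is_RInt_ext with (fun _ => 0).
      - intros x. rewrite Rmin_left, Rmax_right by lra. intros hx. symmetry.
        apply h0. rewrite Rabs_right; lra.
      - apply is_RInt_zero. }
    assert (z : is_RInt u (- M) M (RInt u (- M) M)).
    { apply @RInt_correct, @ex_RInt_continuous. intros; apply hc. }
    pose proof (is_RInt_Chasles u _ _ _ _ _
      (is_RInt_Chasles u _ _ _ _ _ z1 z) z2) as h.
    refine (eq_ind _ (is_RInt u a b) h _ _).
    unfold plus; simpl. ring.
Qed.

Definition box_int (M : R) (u : C -> R) : R :=
  RInt (fun x => RInt (fun y => u (x, y)) (- M) M) (- M) M.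

Lemma ex_RInt_slice (u : C -> R) (x a b : R) :
  smooth_real u -> ex_RInt (fun y => u (x, y)) a b.
Proof.
  intros h. apply @ex_RInt_continuous. intros y _. now apply smooth_real_continuous_y.
Qed.

(** Differentiation under the integral sign, by continuity of [dx u]. It lets an x-derivative leave
    the inner integral. *)
Lemma is_derive_RInt_slice (u : C -> R) (a b x : R) :
  smooth_real u ->
  is_derive (fun t => RInt (fun y => u (t, y)) a b) x
    (RInt (fun y => dx u (x, y)) a b).
Proof.
  intros h. apply (is_derive_RInt_param (fun s t => u (s, t))).
  - apply filter_forall. intros s t _. now apply smooth_real_ex_derive_x.
  - intros t _. apply (smooth_real_continuity (dx u)). now apply smooth_real_dx.
  - apply filter_forall. intros s. now apply ex_RInt_slice.
Qed.

Lemma continuous_RInt_slice (u : C -> R) (a b x : R) :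
  smooth_real u -> continuous (fun t => RInt (fun y => u (t, y)) a b) x.
Proof.
  intros h. apply @ex_derive_continuous. eexists. now apply is_derive_RInt_slice.
Qed.

Lemma ex_RInt_RInt_slice (u : C -> R) (a b c d : R) :
  smooth_real u -> ex_RInt (fun x => RInt (fun y => u (x, y)) a b) c d.
Proof.
  intros h. apply @ex_RInt_continuous. intros x _. now apply continuous_RInt_slice.
Qed.

Lemma int_plane_box (u : C -> R) (M : R) :
  0 <= M -> smooth_real u -> box_supported M u -> int_plane u = box_int M u.
Proof.
  intros hM hu hs. unfold int_plane, box_int.
  replace (fun x => int_line (fun y => u (x, y)))
    with (fun x => RInt (fun y => u (x, y)) (- M) M).
  - apply int_line_compact; [exact hM | intros; now apply continuous_RInt_slice |].
    intros x hx. rewrite (RInt_ext _ (fun _ => 0)).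
    + rewrite RInt_const. apply Rmult_0_r.
    + intros y _. apply hs. now left.
  - apply functional_extensionality; intros x. symmetry.
    apply int_line_compact; [exact hM | intros; now apply smooth_real_continuous_y |].
    intros y hy. apply hs. now right.
Qed.

Lemma box_int_plus (M : R) (u v : C -> R) :
  smooth_real u -> smooth_real v ->
  box_int M (fun z => u z + v z) = box_int M u + box_int M v.
Proof.
  intros hu hv. unfold box_int.
  rewrite (RInt_ext _ (fun x => plus (RInt (fun y => u (x, y)) (- M) M)
                                     (RInt (fun y => v (x, y)) (- M) M))).
  - apply @RInt_plus; now apply ex_RInt_RInt_slice.
  - intros x _. apply @RInt_plus; now apply ex_RInt_slice.
Qed.

(** The outer integrand is the derivative of the inner integral of [u], so only boundary terms
    remain. The strict inequality puts the endpoints where [box_supported] forces the value 0. *)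
Lemma box_int_dx (M M' : R) (u : C -> R) :
  0 <= M < M' -> smooth_real u -> box_supported M u -> box_int M' (dx u) = 0.
Proof.
  intros hM hu hs. unfold box_int.
  set (v := fun x => RInt (fun y => u (x, y)) (- M') M').
  assert (e : forall x, Derive v x = RInt (fun y => dx u (x, y)) (- M') M').
  { intros x. apply is_derive_unique. now apply is_derive_RInt_slice. }
  rewrite (RInt_ext _ (Derive v)) by (intros; symmetry; apply e).
  rewrite RInt_Derive.
  - assert (v0 : forall x, M < Rabs x -> v x = 0).
    { intros x hx. unfold v. rewrite (RInt_ext _ (fun _ => 0)).
      - rewrite RInt_const. apply Rmult_0_r.
      - intros y _. apply hs. now left. }
    rewrite (v0 M') by (rewrite Rabs_right; lra).
    rewrite (v0 (- M')) by (rewrite Rabs_left; lra). apply Rminus_0_r.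
  - intros x _. eexists. now apply is_derive_RInt_slice.
  - intros x _. apply continuous_ext with (2 := continuous_RInt_slice _ (- M') M' x (smooth_real_dx u hu)).
    intros t. symmetry. apply e.
Qed.

Lemma box_int_dy (M M' : R) (u : C -> R) :
  0 <= M < M' -> smooth_real u -> box_supported M u -> box_int M' (dy u) = 0.
Proof.
  intros hM hu hs. unfold box_int.
  rewrite (RInt_ext _ (fun _ => 0)).
  - rewrite RInt_const. apply Rmult_0_r.
  - intros x _. change (RInt (Derive (fun t => u (x, t))) (- M') M' = 0).
    rewrite RInt_Derive.
    + rewrite (hs x M') by (right; rewrite Rabs_right; lra).
      rewrite (hs x (- M')) by (right; rewrite Rabs_left; lra). apply Rminus_0_r.
    + intros y _. now apply smooth_real_ex_derive_y.
    + intros y _. apply (smooth_real_continuous_y (dy u)). now apply smooth_real_dy.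
Qed.

(** Both pieces of the integral cut at t are nonnegative and add up to 0, so t -> RInt g a t
    vanishes on the open interval; its derivative at c is g c. *)
Lemma RInt_eq0 (g : R -> R) (a b : R) :
  (forall x, continuous g x) -> (forall x, 0 <= g x) ->
  RInt g a b = 0 -> forall c, a < c < b -> g c = 0.
Proof.
  intros hc hp h0 c hcab.
  assert (ex : forall s t, ex_RInt g s t).
  { intros s t. apply @ex_RInt_continuous. auto. }
  assert (z : forall t, a < t < b -> RInt g a t = 0).
  { intros t ht. pose proof (RInt_Chasles g a t b (ex _ _) (ex _ _)) as ch.
    rewrite h0 in ch. unfold plus in ch; simpl in ch.
    assert (0 <= RInt g a t) by (apply RInt_ge_0; auto; lra).
    assert (0 <= RInt g t b) by (apply RInt_ge_0; auto; lra).
    lra. }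
  assert (d1 : is_derive (fun t => RInt g a t) c (g c)).
  { apply (is_derive_RInt g _ a c); [| apply hc].
    apply filter_forall. intros t. now apply @RInt_correct. }
  assert (d2 : is_derive (fun t => RInt g a t) c 0).
  { apply is_derive_ext_loc with (fun _ => 0); [| apply @is_derive_const].
    apply (filter_imp (fun t => a < t /\ t < b)).
    - intros t ht. symmetry. now apply z.
    - apply filter_and; [now apply open_gt | now apply open_lt]. }
  rewrite <- (is_derive_unique _ _ _ d1). now apply is_derive_unique.
Qed.

Lemma box_int_eq0 (M : R) (u : C -> R) :
  smooth_real u -> (forall z, 0 <= u z) -> box_int M u = 0 ->
  forall z, Rabs (Re z) < M -> Rabs (Im z) < M -> u z = 0.
Proof.
  intros hu hp h0 [x y] hx hy. simpl in hx, hy.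
  apply Rabs_def2 in hx. apply Rabs_def2 in hy.
  apply (RInt_eq0 (fun t => u (x, t)) (- M) M); auto; try lra.
  - intros t. now apply smooth_real_continuous_y.
  - apply (RInt_eq0 (fun s => RInt (fun t => u (s, t)) (- M) M) (- M) M); auto; try lra.
    + intros s. now apply continuous_RInt_slice.
    + intros s. apply RInt_ge_0; [lra | now apply ex_RInt_slice | auto].
Qed.

(** * Formal adjoints and the gauge transformation *)

Open Scope C_scope.

(** * Calculus of smooth complex-valued functions *)

Lemma smooth_const (c : C) : smooth (fun _ => c).
Proof. split; [exact (smooth_real_const (Re c)) | exact (smooth_real_const (Im c))]. Qed.

Lemma smooth_id : smooth (fun z => z).
Proof. split; [apply smooth_real_Re | apply smooth_real_Im]. Qed.

Lemma smooth_RtoC (u : C -> R) : smooth_real u -> smooth (fun z => RtoC (u z)).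
Proof. intros h. split; [exact h | exact (smooth_real_const 0)]. Qed.

Lemma smooth_plus (f g : C -> C) : smooth f -> smooth g -> smooth (fun z => f z + g z).
Proof.
  intros [f1 f2] [g1 g2].
  exact (conj (smooth_real_plus _ _ f1 g1) (smooth_real_plus _ _ f2 g2)).
Qed.

Lemma smooth_opp (f : C -> C) : smooth f -> smooth (fun z => - f z).
Proof. intros [f1 f2]. exact (conj (smooth_real_opp _ f1) (smooth_real_opp _ f2)). Qed.

Lemma smooth_mult (f g : C -> C) : smooth f -> smooth g -> smooth (fun z => f z * g z).
Proof.
  intros [f1 f2] [g1 g2]. split.
  - apply (smooth_real_minus (fun z => Re (f z) * Re (g z))%R (fun z => Im (f z) * Im (g z))%R);
      now apply smooth_real_mult.
  - apply (smooth_real_plus (fun z => Re (f z) * Im (g z))%R (fun z => Im (f z) * Re (g z))%R);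
      now apply smooth_real_mult.
Qed.

Lemma smooth_conj (f : C -> C) : smooth f -> smooth (fun z => Cconj (f z)).
Proof. intros [f1 f2]. split; [exact f1 | exact (smooth_real_opp _ f2)]. Qed.

Lemma smooth_partial_x (f : C -> C) : smooth f -> smooth (partial_x f).
Proof. intros [f1 f2]. exact (conj (smooth_real_dx _ f1) (smooth_real_dx _ f2)). Qed.

Lemma smooth_partial_y (f : C -> C) : smooth f -> smooth (partial_y f).
Proof. intros [f1 f2]. exact (conj (smooth_real_dy _ f1) (smooth_real_dy _ f2)). Qed.

Lemma smooth_cis (u : C -> R) : smooth_real u -> smooth (fun z => cis (u z)).
Proof. exact (smooth_real_cos_sin u). Qed.

Lemma smooth_W (phi : C -> R) (f : C -> C) :
  smooth_real phi -> smooth f -> smooth (W phi f).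
Proof. intros hp hf. apply smooth_mult; [now apply smooth_cis | exact hf]. Qed.

Lemma Derive_mult_C (u1 u2 v1 v2 : R -> R) (x : R) :
  ex_derive u1 x -> ex_derive u2 x -> ex_derive v1 x -> ex_derive v2 x ->
  (Derive (fun t => u1 t * v1 t - u2 t * v2 t)%R x,
   Derive (fun t => u1 t * v2 t + u2 t * v1 t)%R x) =
  (Derive u1 x, Derive u2 x) * (v1 x, v2 x) +
  (u1 x, u2 x) * (Derive v1 x, Derive v2 x).
Proof.
  intros hu1 hu2 hv1 hv2.
  rewrite Derive_minus, Derive_plus by now apply ex_derive_mult.
  rewrite !Derive_mult by assumption.
  unfold Cmult, Cplus; simpl. f_equal; ring.
Qed.

Lemma partial_x_mult (f g : C -> C) (z : C) :
  smooth f -> smooth g ->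
  partial_x (fun w => f w * g w) z = partial_x f z * g z + f z * partial_x g z.
Proof.
  intros [f1 f2] [g1 g2]. destruct z as [x y].
  pose proof (Derive_mult_C (fun t => Re (f (t, y))) (fun t => Im (f (t, y)))
    (fun t => Re (g (t, y))) (fun t => Im (g (t, y))) x
    (smooth_real_ex_derive_x _ x y f1) (smooth_real_ex_derive_x _ x y f2)
    (smooth_real_ex_derive_x _ x y g1) (smooth_real_ex_derive_x _ x y g2)) as e.
  unfold partial_x, Re, Im in *; simpl in *. rewrite e.
  now destruct (f (x, y)), (g (x, y)).
Qed.

Lemma partial_y_mult (f g : C -> C) (z : C) :
  smooth f -> smooth g ->
  partial_y (fun w => f w * g w) z = partial_y f z * g z + f z * partial_y g z.
Proof.
  intros [f1 f2] [g1 g2]. destruct z as [x y].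
  pose proof (Derive_mult_C (fun t => Re (f (x, t))) (fun t => Im (f (x, t)))
    (fun t => Re (g (x, t))) (fun t => Im (g (x, t))) y
    (smooth_real_ex_derive_y _ x y f1) (smooth_real_ex_derive_y _ x y f2)
    (smooth_real_ex_derive_y _ x y g1) (smooth_real_ex_derive_y _ x y g2)) as e.
  unfold partial_y, Re, Im in *; simpl in *. rewrite e.
  now destruct (f (x, y)), (g (x, y)).
Qed.

Lemma partial_x_conj (f : C -> C) (z : C) :
  partial_x (fun w => Cconj (f w)) z = Cconj (partial_x f z).
Proof. unfold partial_x, Cconj; simpl. now rewrite Derive_opp. Qed.

Lemma partial_y_conj (f : C -> C) (z : C) :
  partial_y (fun w => Cconj (f w)) z = Cconj (partial_y f z).
Proof. unfold partial_y, Cconj; simpl. now rewrite Derive_opp. Qed.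

Lemma Derive_cos_comp (u : R -> R) (x : R) :
  ex_derive u x -> Derive (fun t => cos (u t)) x = (- (Derive u x * sin (u x)))%R.
Proof.
  intros h. rewrite (Derive_comp cos u) by (auto; eexists; apply is_derive_cos).
  rewrite (is_derive_unique _ _ _ (is_derive_cos (u x))). ring.
Qed.

Lemma Derive_sin_comp (u : R -> R) (x : R) :
  ex_derive u x -> Derive (fun t => sin (u t)) x = (Derive u x * cos (u x))%R.
Proof.
  intros h. rewrite (Derive_comp sin u) by (auto; eexists; apply is_derive_sin).
  now rewrite (is_derive_unique _ _ _ (is_derive_sin (u x))).
Qed.

(** The right side is phrased with the coefficient of i d phi occurring in [is_phase], so that the
    two match syntactically later on. *)
Lemma partial_x_cis (phi : C -> R) (z : C) :
  smooth_real phi ->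
  partial_x (fun w => cis (phi w)) z =
  cis (phi z) * (Ci * partial_x (fun w => RtoC (phi w)) z).
Proof.
  intros h. destruct z as [x y]. unfold partial_x, cis, Re, Im; simpl.
  pose proof (smooth_real_ex_derive_x phi x y h) as hd.
  rewrite Derive_const, (Derive_cos_comp (fun t => phi (t, y))),
    (Derive_sin_comp (fun t => phi (t, y))) by exact hd.
  unfold Cmult; simpl. f_equal; ring.
Qed.

Lemma partial_y_cis (phi : C -> R) (z : C) :
  smooth_real phi ->
  partial_y (fun w => cis (phi w)) z =
  cis (phi z) * (Ci * partial_y (fun w => RtoC (phi w)) z).
Proof.
  intros h. destruct z as [x y]. unfold partial_y, cis, Re, Im; simpl.
  pose proof (smooth_real_ex_derive_y phi x y h) as hd.
  rewrite Derive_const, (Derive_cos_comp (fun t => phi (x, t))),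
    (Derive_sin_comp (fun t => phi (x, t))) by exact hd.
  unfold Cmult; simpl. f_equal; ring.
Qed.

(** * Integration by parts on the plane *)

(** If M < |x|, this persists for nearby abscissas because the condition is open; if M < |y|, the
    whole horizontal line lies outside the square. Either way the differentiated function is locally
    0. *)
Lemma box_supported_dx (M : R) (u : C -> R) :
  box_supported M u -> box_supported M (dx u).
Proof.
  intros h x y hxy. unfold dx; simpl.
  rewrite (Derive_ext_loc _ (fun _ => 0%R)); [apply Derive_const |].
  destruct hxy as [hx | hy].
  - apply (filter_imp (fun t => M < Rabs t)%R); [intros t ht; apply h; now left |].
    apply (continuous_Rabs x). now apply open_gt.
  - apply filter_forall. intros t. apply h. now right.
Qed.

Lemma box_supported_dy (M : R) (u : C -> R) :
  box_supported M u -> box_supported M (dy u).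
Proof.
  intros h x y hxy. unfold dy; simpl.
  rewrite (Derive_ext_loc _ (fun _ => 0%R)); [apply Derive_const |].
  destruct hxy as [hx | hy].
  - apply filter_forall. intros t. apply h. now left.
  - apply (filter_imp (fun t => M < Rabs t)%R); [intros t ht; apply h; now right |].
    apply (continuous_Rabs y). now apply open_gt.
Qed.

Lemma box_supported_plus (M : R) (u v : C -> R) :
  box_supported M u -> box_supported M v -> box_supported M (fun z => u z + v z)%R.
Proof. intros hu hv x y h. rewrite hu, hv by exact h. apply Rplus_0_r. Qed.

Lemma int_plane_plus (M : R) (u v : C -> R) :
  (0 <= M)%R -> smooth_real u -> smooth_real v ->
  box_supported M u -> box_supported M v ->
  int_plane (fun z => u z + v z)%R = (int_plane u + int_plane v)%R.
Proof.
  intros hM hu hv su sv.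
  rewrite !(int_plane_box _ M); auto using smooth_real_plus, box_supported_plus.
  now apply box_int_plus.
Qed.

Lemma box_supported_le (M M' : R) (u : C -> R) :
  (M <= M')%R -> box_supported M u -> box_supported M' u.
Proof. intros hM h x y [hx | hy]; apply h; [left | right]; lra. Qed.

Lemma int_plane_dx (M : R) (u : C -> R) :
  (0 <= M)%R -> smooth_real u -> box_supported M u -> int_plane (dx u) = 0%R.
Proof.
  (* The larger square makes the inequality of [box_int_dx] strict. *)
  intros hM hu su. rewrite (int_plane_box _ (M + 1)).
  - apply (box_int_dx M); auto; lra.
  - lra.
  - now apply smooth_real_dx.
  - apply box_supported_le with M; [lra | now apply box_supported_dx].
Qed.

Lemma int_plane_dy (M : R) (u : C -> R) :
  (0 <= M)%R -> smooth_real u -> box_supported M u -> int_plane (dy u) = 0%R.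
Proof.
  intros hM hu su. rewrite (int_plane_box _ (M + 1)).
  - apply (box_int_dy M); auto; lra.
  - lra.
  - now apply smooth_real_dy.
  - apply box_supported_le with M; [lra | now apply box_supported_dy].
Qed.

Lemma int_plane_divergence (M : R) (u p q : C -> R) :
  (0 <= M)%R -> smooth_real u -> smooth_real p -> smooth_real q ->
  box_supported M u -> box_supported M p -> box_supported M q ->
  int_plane (fun z => u z + (dx p z + dy q z))%R = int_plane u.
Proof.
  intros hM hu hp hq su sp sq.
  assert (hp' := smooth_real_dx p hp). assert (hq' := smooth_real_dy q hq).
  assert (sp' := box_supported_dx M p sp). assert (sq' := box_supported_dy M q sq).
  rewrite (int_plane_plus M u (fun z => dx p z + dy q z)%R);
    auto using smooth_real_plus, box_supported_plus.
  rewrite (int_plane_plus M (dx p) (dy q)) by assumption.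
  rewrite (int_plane_dx M), (int_plane_dy M) by assumption. ring.
Qed.

Lemma compact_support_box (f : C -> C) :
  compact_support f -> exists M : R, (0 <= M)%R /\
    forall x y : R, (M < Rabs x \/ M < Rabs y)%R -> f (x, y) = 0.
Proof.
  intros [M hM]. exists (Rmax 0 M). split; [apply Rmax_l |].
  intros x y h. apply hM.
  pose proof (Rmax_r 0 M). pose proof (Rmax_Cmod (x, y)) as hc; simpl in hc.
  pose proof (Rmax_l (Rabs x) (Rabs y)). pose proof (Rmax_r (Rabs x) (Rabs y)).
  destruct h; lra.
Qed.

(** Integration by parts in divergence form: it turns an adjointness identity between integrals into
    a pointwise identity between integrands. *)
Lemma Cint_plane_divergence (M : R) (f p q : C -> C) :
  (0 <= M)%R -> smooth f -> smooth p -> smooth q ->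
  (forall x y : R, (M < Rabs x \/ M < Rabs y)%R ->
    f (x, y) = 0 /\ p (x, y) = 0 /\ q (x, y) = 0) ->
  Cint_plane (fun z => f z + (partial_x p z + partial_y q z)) = Cint_plane f.
Proof.
  intros hM [f1 f2] [p1 p2] [q1 q2] s. unfold Cint_plane. f_equal.
  - apply (int_plane_divergence M (fun z => Re (f z)) (fun z => Re (p z))
      (fun z => Re (q z))); auto; intros x y h;
      destruct (s x y h) as [e1 [e2 e3]]; rewrite ?e1, ?e2, ?e3; reflexivity.
  - apply (int_plane_divergence M (fun z => Im (f z)) (fun z => Im (p z))
      (fun z => Im (q z))); auto; intros x y h;
      destruct (s x y h) as [e1 [e2 e3]]; rewrite ?e1, ?e2, ?e3; reflexivity.
Qed.

(** * Existence and uniqueness of the formal adjoint *)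

Lemma smooth_nabla (theta : form1) (f : C -> C) :
  smooth_form theta -> smooth f -> smooth_form (nabla theta f).
Proof.
  intros [t1 t2] hf. split; apply smooth_plus.
  - exact (smooth_partial_x f hf).
  - exact (smooth_mult f _ hf t1).
  - exact (smooth_partial_y f hf).
  - exact (smooth_mult f _ hf t2).
Qed.

(** Minus the divergence is the adjoint of d; contraction with the conjugate of [theta] is the
    adjoint of ext [theta]. The formula serves as the existence witness behind [epsilon]. *)
Definition nabla_adjoint (theta w : form1) (z : C) : C :=
  - (partial_x (fun v => fst (w v)) z + partial_y (fun v => snd (w v)) z)
  + (Cconj (fst (theta z)) * fst (w z) + Cconj (snd (theta z)) * snd (w z)).

Lemma is_formal_adjoint_nabla (theta : form1) :
  smooth_form theta -> is_formal_adjoint (nabla theta) (nabla_adjoint theta).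
Proof.
  intros [t1 t2] w [w1 w2].
  assert (sa : smooth (nabla_adjoint theta w)).
  { apply smooth_plus.
    - apply smooth_opp, smooth_plus;
        [apply (smooth_partial_x _ w1) | apply (smooth_partial_y _ w2)].
    - apply smooth_plus; apply smooth_mult; auto using smooth_conj. }
  split; [exact sa |]. intros f hf cf.
  destruct (compact_support_box f cf) as [M [hM s]].
  unfold L2_form, L2_fun.
  (* The field f conj(w) has as divergence exactly the difference of the two integrands, and it
     inherits compact support from [f]. *)
  rewrite <- (Cint_plane_divergence M
    (fun z => f z * Cconj (nabla_adjoint theta w z))
    (fun z => f z * Cconj (fst (w z))) (fun z => f z * Cconj (snd (w z)))).
  - f_equal. apply functional_extensionality; intros z.
    rewrite partial_x_mult, partial_y_mult, partial_x_conj, partial_y_conj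
      by auto using smooth_conj.
    unfold nabla_adjoint, nabla, form_add, form_mul, diff; simpl.
    rewrite !Cplus_conj, Copp_conj, !Cplus_conj, !Cmult_conj, !Cconj_conj. ring.
  - exact hM.
  - auto using smooth_mult, smooth_conj.
  - auto using smooth_mult, smooth_conj.
  - auto using smooth_mult, smooth_conj.
  - intros x y h. cbv beta. rewrite !(s x y h), !Cmult_0_l. auto.
Qed.

Lemma formal_adjoint_spec (theta : form1) :
  smooth_form theta -> is_formal_adjoint (nabla theta) (formal_adjoint (nabla theta)).
Proof.
  intros h. unfold formal_adjoint. apply epsilon_spec. exists (nabla_adjoint theta).
  now apply is_formal_adjoint_nabla.
Qed.

(* Test against [b * (g - h)], with [b] a bump function. *)
Lemma smooth_weak_eq (g h : C -> C) :
  smooth g -> smooth h ->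
  (forall f, smooth f -> compact_support f -> L2_fun f g = L2_fun f h) ->
  forall z, g z = h z.
Proof.
  intros hg hh e z.
  (* This radius places [z] strictly inside the region where the bump is positive. *)
  assert (hr : (0 < Cmod z + 1)%R) by (pose proof (Cmod_ge_0 z); lra).
  destruct (smooth_bump _ hr) as [b [hb [bpos b0]]].
  set (r := (Cmod z + 1)%R) in *.
  set (d := fun w => g w + - h w).
  assert (hd : smooth d) by (apply smooth_plus; [exact hg | now apply smooth_opp]).
  set (f := fun w => RtoC (b w) * d w).
  assert (hf : smooth f) by (apply smooth_mult; [now apply smooth_RtoC | exact hd]).
  assert (f0 : forall w, (r <= Cmod w)%R -> f w = 0).
  { intros w hw. unfold f. rewrite (b0 w hw). ring. }
  assert (cf : compact_support f).
  { exists r. intros w hw. apply f0. lra. }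
  assert (s : forall x y : R, (r < Rabs x \/ r < Rabs y)%R -> r <= Cmod (x, y)).
  { intros x y hxy. pose proof (Rmax_Cmod (x, y)) as hc; simpl in hc.
    pose proof (Rmax_l (Rabs x) (Rabs y)). pose proof (Rmax_r (Rabs x) (Rabs y)).
    destruct hxy; lra. }
  set (n := fun w => (b w * (Re (d w) * Re (d w) + Im (d w) * Im (d w)))%R).
  assert (hn : smooth_real n).
  { apply smooth_real_mult; [exact hb |].
    apply smooth_real_plus; apply smooth_real_mult; apply hd. }
  assert (sn : box_supported r n).
  { intros x y hxy. unfold n. rewrite b0 by now apply s. apply Rmult_0_l. }
  (* Since f = b (g - h), the product f conj(g - h) is the nonnegative function n = b |g - h|^2, so
     the real parts of the two pairings differ by the integral of [n]. *)
  assert (E : int_plane (fun w => Re (f w * Cconj (g w))) =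
              (int_plane (fun w => Re (f w * Cconj (h w))) + int_plane n)%R).
  { rewrite <- (int_plane_plus r).
    - f_equal. apply functional_extensionality; intros w.
      unfold n, f, d, Re, Im, Cmult, Cplus, Copp, Cconj; simpl. ring.
    - lra.
    - apply (smooth_mult f _ hf (smooth_conj h hh)).
    - exact hn.
    - intros x y hxy. rewrite f0 by now apply s. unfold Re, Cmult; simpl. ring.
    - exact sn. }
  assert (e1 : int_plane (fun w => Re (f w * Cconj (g w))) =
               int_plane (fun w => Re (f w * Cconj (h w))))
    by exact (f_equal fst (e f hf cf)).
  rewrite e1 in E.
  assert (I0 : int_plane n = 0%R) by lra.
  rewrite (int_plane_box n r) in I0 by (auto; lra).
  assert (nz : n z = 0%R).
  { pose proof (Rmax_Cmod z).
    pose proof (Rmax_l (Rabs (fst z)) (Rabs (snd z))).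
    pose proof (Rmax_r (Rabs (fst z)) (Rabs (snd z))).
    apply (box_int_eq0 r); auto; unfold r, Re, Im; try lra.
    intros w. unfold n. apply Rmult_le_pos; [| nra].
    destruct (Rlt_dec (Cmod w) r) as [hw | hw]; [now apply Rlt_le, bpos |].
    rewrite b0; lra. }
  assert (bz : (0 < b z)%R) by (apply bpos; unfold r; lra).
  unfold n in nz.
  assert (dz : Re (d z) = 0%R /\ Im (d z) = 0%R).
  { apply Rmult_integral in nz. destruct nz; [lra | split; nra]. }
  assert (D : d z = 0) by (apply injective_projections; apply dz).
  unfold d in D.
  replace (g z) with (g z + - h z + h z) by ring. rewrite D. ring.
Qed.

(** * Gauge transformation of the adjoint and of the Laplacian *)

Lemma cis_plus (s t : R) : cis (s + t) = cis s * cis t.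
Proof. unfold cis, Cmult; simpl. rewrite cos_plus, sin_plus. f_equal; ring. Qed.

Lemma cis_conj (t : R) : Cconj (cis t) = cis (- t).
Proof. unfold cis, Cconj; simpl. now rewrite cos_neg, sin_neg. Qed.

Lemma cis_opp_r (t : R) : cis t * cis (- t) = 1.
Proof.
  rewrite <- cis_plus, Rplus_opp_r. unfold cis. now rewrite cos_0, sin_0.
Qed.

(** Writing U for multiplication by [cis phi], unitary on functions and on forms: from nabla' U = U
    nabla one gets <f, nabla'^* U w> = <U nabla g, U w> = <g, nabla^* w> = <f, U nabla^* w> for
    every test function f = U g. *)
Lemma formal_adjoint_gauge (theta theta' : form1) (phi : C -> R) :
  smooth_form theta -> smooth_form theta' -> smooth_real phi ->
  (forall f, smooth f ->
    nabla theta' (W phi f) = form_mul (fun z => cis (phi z)) (nabla theta f)) ->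
  forall w, smooth_form w -> forall z,
    formal_adjoint (nabla theta') (form_mul (fun v => cis (phi v)) w) z =
    W phi (formal_adjoint (nabla theta) w) z.
Proof.
  intros ht ht' hp hc w hw.
  assert (sc := smooth_cis phi hp).
  assert (hw' : smooth_form (form_mul (fun v => cis (phi v)) w)).
  { split; apply (smooth_mult (fun v => cis (phi v))); auto; apply hw. }
  destruct (formal_adjoint_spec theta ht w hw) as [s1 a1].
  destruct (formal_adjoint_spec theta' ht' _ hw') as [s2 a2].
  apply smooth_weak_eq; [exact s2 | now apply smooth_W |].
  intros f hf cf.
  (* The test function is pulled back through U so that the intertwining hypothesis applies to
     it. *)
  set (g := W (fun z => (- phi z)%R) f).
  assert (hg : smooth g) by (apply smooth_W; [now apply smooth_real_opp | exact hf]).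
  assert (cg : compact_support g).
  { destruct cf as [M h]. exists M. intros z hz. unfold g, W. rewrite (h z hz). ring. }
  assert (ef : f = W phi g).
  { apply functional_extensionality; intros z. unfold g, W.
    rewrite Cmult_assoc, cis_opp_r. ring. }
  assert (u : forall z, cis (phi z) * Cconj (cis (phi z)) = 1).
  { intros z. rewrite cis_conj. apply cis_opp_r. }
  rewrite <- a2 by assumption.
  rewrite ef at 1. rewrite hc by exact hg.
  transitivity (L2_form (nabla theta g) w).
  - unfold L2_form. f_equal. apply functional_extensionality; intros z.
    unfold form_mul. destruct (nabla theta g z) as [p q], (w z) as [p' q']; simpl.
    rewrite !Cmult_conj.
    replace (p * Cconj p' + q * Cconj q')
      with (cis (phi z) * Cconj (cis (phi z)) * (p * Cconj p' + q * Cconj q'))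
      by (rewrite u; ring).
    ring.
  - rewrite a1 by assumption. rewrite ef.
    unfold L2_fun. f_equal. apply functional_extensionality; intros z.
    unfold W. rewrite Cmult_conj.
    set (p := Cconj (formal_adjoint (nabla theta) w z)).
    replace (g z * p) with (cis (phi z) * Cconj (cis (phi z)) * (g z * p))
      by (rewrite u; ring).
    ring.
Qed.

(** The term i f d phi that the product rule produces from [cis phi] is exactly what turns [theta']
    into [theta]; the outer adjoint follows by [formal_adjoint_gauge]. *)
Lemma H_gauge (theta theta' : form1) (phi : C -> R) (f : C -> C) (z : C) :
  smooth_form theta -> smooth_form theta' -> smooth_real phi ->
  (forall w, theta w = form_add theta'
    (form_mul (fun _ => Ci) (diff (fun v => RtoC (phi v)))) w) ->
  smooth f -> H theta' (W phi f) z = W phi (H theta f) z.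
Proof.
  intros ht ht' hp e hf.
  assert (K : forall g, smooth g -> nabla theta' (W phi g) =
    form_mul (fun z => cis (phi z)) (nabla theta g)).
  { intros g hg. apply functional_extensionality; intros w.
    unfold nabla, form_add, form_mul, diff, W; simpl. rewrite e.
    unfold form_add, form_mul, diff; simpl.
    rewrite partial_x_mult, partial_y_mult, partial_x_cis, partial_y_cis
      by auto using smooth_cis.
    f_equal; ring. }
  unfold H. rewrite K by exact hf.
  apply formal_adjoint_gauge; auto. now apply smooth_nabla.
Qed.

Lemma smooth_theta_of (c : R) (f : C -> C) : smooth f -> smooth_form (theta_of c f).
Proof.
  intros hf. assert (hc := smooth_conj f hf).
  split; (apply (smooth_mult (fun _ => - (RtoC c / 2))); [apply smooth_const |]);
    apply smooth_plus.
  - exact (smooth_mult _ _ hc (smooth_partial_x f hf)).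
  - exact (smooth_mult _ _ (smooth_opp f hf) (smooth_partial_x _ hc)).
  - exact (smooth_mult _ _ hc (smooth_partial_y f hf)).
  - exact (smooth_mult _ _ (smooth_opp f hf) (smooth_partial_y _ hc)).
Qed.

Lemma Delta_gauge (nu mu : R) (tau : C -> C) (phi : C -> R) (f : C -> C) (z : C) :
  smooth tau -> is_phase nu mu tau phi -> smooth f ->
  Delta_B (B_const nu mu tau) (W phi f) z = W phi (Delta_mixed nu mu tau f) z.
Proof.
  intros ht [hp e] hf. unfold Delta_B, Delta_mixed.
  rewrite (H_gauge (theta_mixed nu mu tau) (theta_B (B_const nu mu tau)) phi).
  - unfold W. ring.
  - pose proof (smooth_theta_of nu _ smooth_id) as [a1 a2].
    pose proof (smooth_theta_of mu _ ht) as [b1 b2].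
    exact (conj (smooth_plus _ _ a1 b1) (smooth_plus _ _ a2 b2)).
  - apply smooth_theta_of, smooth_id.
  - exact hp.
  - exact e.
  - exact hf.
Qed.

(** * Automorphy factors *)

Definition ddir (u : C -> R) (z h : C) : R := (dx u z * Re h + dy u z * Im h)%R.

Definition Cddir (f : C -> C) (z h : C) : C :=
  (ddir (fun w => Re (f w)) z h, ddir (fun w => Im (f w)) z h).

(** Continuity of [dx u] upgrades the partial derivatives to a true differential, needed for the
    chain rule along oblique lines. *)
Lemma smooth_real_differentiable (u : C -> R) (x y : R) :
  smooth_real u ->
  differentiable_pt_lim (fun s t => u (s, t)) x y (dx u (x, y)) (dy u (x, y)).
Proof.
  intros h. apply filterdiff_differentiable_pt_lim.
  apply (is_derive_filterdiff (fun s t => u (s, t)) x y (fun s t => dx u (s, t))).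
  - apply filter_forall. intros [s t].
    apply (Derive_correct (fun r => u (r, t))). now apply smooth_real_ex_derive_x.
  - apply (Derive_correct (fun r => u (x, r))). now apply smooth_real_ex_derive_y.
  - apply (proj1 (continuity_2d_pt_filterlim (fun s t => dx u (s, t)) x y)).
    now apply smooth_real_continuity, smooth_real_dx.
Qed.

Lemma is_derive_line (u : C -> R) (z h : C) (t : R) :
  smooth_real u ->
  is_derive (fun s : R => u (z + RtoC s * h)) t (ddir u (z + RtoC t * h) h).
Proof.
  intros hu.
  apply (is_derive_ext (fun s : R => u (Re z + s * Re h, Im z + s * Im h)%R)).
  { intros s. f_equal. unfold Cplus, Cmult, RtoC, Re, Im; simpl. f_equal; ring. }
  apply is_derive_Reals. unfold ddir.
  replace (z + RtoC t * h) with (Re z + t * Re h, Im z + t * Im h)%R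
    by (unfold Cplus, Cmult, RtoC, Re, Im; simpl; f_equal; ring).
  apply (derivable_pt_lim_comp_2d (fun s r => u (s, r))).
  - now apply smooth_real_differentiable.
  - apply is_derive_Reals. auto_derive; trivial. ring.
  - apply is_derive_Reals. auto_derive; trivial. ring.
Qed.

Lemma act_line (g : G) (w h : C) (t : R) :
  act g (w + RtoC t * h) = act g w + RtoC t * (rot g * h).
Proof. unfold act. ring. Qed.

(** The action is affine, so it carries the line through [w] along [h] to the line through [act g w]
    along [rot g * h]; equivariance along these lines is differentiated at parameter 0. *)
Lemma Cddir_equivariant (rho : G -> G) (tau : C -> C) (g : G) (w h : C) :
  equivariant_pair rho tau -> smooth tau ->
  Cddir tau (act g w) (rot g * h) = rot (rho g) * Cddir tau w h.
Proof.
  intros [_ eq] [t1 t2].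
  pose proof (is_derive_line _ w h 0 t1) as r1.
  pose proof (is_derive_line _ w h 0 t2) as r2.
  pose proof (is_derive_line _ (act g w) (rot g * h) 0 t1) as l1.
  pose proof (is_derive_line _ (act g w) (rot g * h) 0 t2) as l2.
  replace (w + RtoC 0 * h) with w in r1, r2 by ring.
  replace (act g w + RtoC 0 * (rot g * h)) with (act g w) in l1, l2 by ring.
  set (a := rot (rho g)). set (b := trans (rho g)).
  assert (E : forall s : R, tau (act g w + RtoC s * (rot g * h)) =
                            a * tau (w + RtoC s * h) + b).
  { intros s. rewrite <- act_line, eq. reflexivity. }
  set (u := fun s : R => Re (tau (w + RtoC s * h))) in *.
  set (v := fun s : R => Im (tau (w + RtoC s * h))) in *.
  assert (m1 : is_derive (fun s : R => Re (tau (act g w + RtoC s * (rot g * h)))) 0%R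
    (Re a * ddir (fun z => Re (tau z)) w h - Im a * ddir (fun z => Im (tau z)) w h)%R).
  { apply (is_derive_ext (fun s => Re a * u s - Im a * v s + Re b)%R).
    - intros s. rewrite E. reflexivity.
    - clearbody u v. auto_derive.
      + split; [eexists; exact r1 | split; [eexists; exact r2 | exact I]].
      + rewrite (is_derive_unique u _ _ r1 : Derive (fun x : R => u x) _ = _),
          (is_derive_unique v _ _ r2 : Derive (fun x : R => v x) _ = _). ring. }
  assert (m2 : is_derive (fun s : R => Im (tau (act g w + RtoC s * (rot g * h)))) 0%R
    (Re a * ddir (fun z => Im (tau z)) w h + Im a * ddir (fun z => Re (tau z)) w h)%R).
  { apply (is_derive_ext (fun s => Re a * v s + Im a * u s + Im b)%R).
    - intros s. rewrite E. reflexivity.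
    - clearbody u v. auto_derive.
      + split; [eexists; exact r2 | split; [eexists; exact r1 | exact I]].
      + rewrite (is_derive_unique u _ _ r1 : Derive (fun x : R => u x) _ = _),
          (is_derive_unique v _ _ r2 : Derive (fun x : R => v x) _ = _). ring. }
  apply is_derive_unique in l1, l2, m1, m2.
  unfold Cddir. rewrite <- l1, <- l2, m1, m2. reflexivity.
Qed.

(** conj(f) df - f d(conj f) is 2i times Im(conj(f) df), which makes the coefficients purely
    imaginary. *)
Lemma theta_of_fst (c : R) (f : C -> C) (z : C) :
  fst (theta_of c f z) = (0, - (c * Im (Cconj (f z) * partial_x f z)))%R.
Proof.
  unfold theta_of, form_mul, form_add, diff; cbn [fst].
  rewrite partial_x_conj, <- RtoC_div by lra.
  destruct (f z) as [a b], (partial_x f z) as [p q].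
  unfold Cmult, Cplus, Copp, Cconj, RtoC, Im; simpl. f_equal; field.
Qed.

Lemma theta_of_snd (c : R) (f : C -> C) (z : C) :
  snd (theta_of c f z) = (0, - (c * Im (Cconj (f z) * partial_y f z)))%R.
Proof.
  unfold theta_of, form_mul, form_add, diff; cbn [snd].
  rewrite partial_y_conj, <- RtoC_div by lra.
  destruct (f z) as [a b], (partial_y f z) as [p q].
  unfold Cmult, Cplus, Copp, Cconj, RtoC, Im; simpl. f_equal; field.
Qed.

Lemma partial_x_id (z : C) : partial_x (fun w => w) z = (1, 0)%R.
Proof. unfold partial_x, Re, Im; simpl. now rewrite Derive_id, Derive_const. Qed.

Lemma partial_y_id (z : C) : partial_y (fun w => w) z = (0, 1)%R.
Proof. unfold partial_y, Re, Im; simpl. now rewrite Derive_id, Derive_const. Qed.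

(** The imaginary part of i d phi = [theta_mixed] - [theta_B], evaluated on the tangent vector [h].
    The terms in nu and B merge because both forms are built on the identity map. *)
Lemma phase_ddir (nu mu : R) (tau : C -> C) (phi : C -> R) (z h : C) :
  is_phase nu mu tau phi ->
  ddir phi z h =
  (- ((nu - B_const nu mu tau) * Im (Cconj z * h)
      + mu * Im (Cconj (tau z) * Cddir tau z h)))%R.
Proof.
  intros [_ e]. specialize (e z).
  set (B := B_const nu mu tau) in *.
  assert (ex := f_equal (fun w => Im (fst w)) e).
  assert (ey := f_equal (fun w => Im (snd w)) e).
  unfold theta_mixed, theta_B, form_add in ex, ey; cbn [fst snd] in ex, ey.
  rewrite !theta_of_fst, partial_x_id in ex. rewrite !theta_of_snd, partial_y_id in ey.
  unfold form_mul, diff in ex, ey; cbn [fst snd] in ex, ey.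
  assert (px : partial_x (fun v => RtoC (phi v)) z = RtoC (dx phi z)).
  { unfold partial_x, RtoC, dx, Re, Im; simpl. now rewrite Derive_const. }
  assert (py : partial_y (fun v => RtoC (phi v)) z = RtoC (dy phi z)).
  { unfold partial_y, RtoC, dy, Re, Im; simpl. now rewrite Derive_const. }
  rewrite px in ex. rewrite py in ey.
  unfold Cddir, ddir, partial_x, partial_y in *.
  fold (dx (fun w => Re (tau w)) z) (dx (fun w => Im (tau w)) z) in ex.
  fold (dy (fun w => Re (tau w)) z) (dy (fun w => Im (tau w)) z) in ey.
  set (p1 := dx (fun w => Re (tau w)) z) in *.
  set (p2 := dx (fun w => Im (tau w)) z) in *.
  set (q1 := dy (fun w => Re (tau w)) z) in *.
  set (q2 := dy (fun w => Im (tau w)) z) in *.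
  destruct z as [x y], h as [h1 h2], (tau (x, y)) as [t1 t2].
  unfold Cmult, Cplus, Cconj, RtoC, Ci, Re, Im in *; simpl in *.
  assert (ex' : dx phi (x, y) = ((nu - B) * y - mu * (t1 * p2 - t2 * p1))%R) by lra.
  assert (ey' : dy phi (x, y) = (- (nu - B) * x - mu * (t1 * q2 - t2 * q1))%R) by lra.
  rewrite ex', ey'. ring.
Qed.

(** With g = [a, b] and |a| = 1, the left side expands to Im(conj(w) v) + Im(conj(b) a v); since
    g^-1 0 = -conj(a) b, the cross term is -Im<v, g^-1 0>. *)
Lemma Im_conj_act (g : G) (w v : C) :
  Im (Cconj (act g w) * (rot g * v)) =
  (Im (Cconj w * v) - Im (herm v (act (ginv g) 0)))%R.
Proof.
  assert (u : (Re (rot g) * Re (rot g) + Im (rot g) * Im (rot g) = 1)%R).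
  { rewrite <- Cmod_sqr, rot_unit. ring. }
  unfold herm, act, ginv, Re, Im in *; simpl in *.
  destruct (rot g) as [a1 a2], (trans g) as [b1 b2], w as [w1 w2], v as [v1 v2].
  simpl in *.
  (* Inserting |a|^2 = 1 as a factor makes the identity purely polynomial. *)
  replace (w1 * v2 + - w2 * v1)%R with ((a1 * a1 + a2 * a2) * (w1 * v2 + - w2 * v1))%R
    by (rewrite u; ring).
  ring.
Qed.

(* The derivative of the left side along the ray [t * z] vanishes: the
   automorphy exponents are primitives of [g^* (d phi) - d phi]. *)
Lemma phase_cocycle (nu mu : R) (rho : G -> G) (tau : C -> C) (phi : C -> R)
    (g : G) (z : C) :
  equivariant_pair rho tau -> smooth tau -> is_phase nu mu tau phi ->
  (phi (act g z) - phi z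
   - (nu - B_const nu mu tau) * Im (herm z (act (ginv g) 0))
   - mu * Im (herm (tau z) (act (ginv (rho g)) 0)) =
   phi (act g 0) - phi 0 - mu * Im (herm (tau 0) (act (ginv (rho g)) 0)))%R.
Proof.
  intros he ht hphi.
  set (B := B_const nu mu tau).
  set (k := act (ginv g) 0). set (k' := act (ginv (rho g)) 0).
  (* The ray and its image under [g] are both written as a base point plus t times a direction, the
     form required by [is_derive_line]; the first exponent is already factored as linear in t. *)
  set (psi := fun t : R =>
    (phi (act g 0 + RtoC t * (rot g * z))%C - phi (0 + RtoC t * z)%C
     - (nu - B) * (t * Im (herm z k)) - mu * Im (herm (tau (0 + RtoC t * z)%C) k'))%R).
  assert (D : forall t, is_derive psi t 0%R).
  { intros t.
    pose proof (is_derive_line phi (act g 0) (rot g * z) t (proj1 hphi)) as d1.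
    pose proof (is_derive_line phi 0 z t (proj1 hphi)) as d2.
    pose proof (is_derive_line _ 0 z t (proj1 ht)) as d3.
    pose proof (is_derive_line _ 0 z t (proj2 ht)) as d4.
    rewrite <- act_line in d1.
    (* In [d1], [Im_conj_act] acts twice: for [g] at the point of the ray and for [rho g] at the
       value of [tau]. Subtracting [d2] then leaves exactly the derivatives of the two exponents. *)
    rewrite (phase_ddir nu mu tau phi) in d1, d2 by exact hphi.
    rewrite (Cddir_equivariant rho) in d1 by assumption.
    rewrite (proj2 he), !Im_conj_act in d1. fold B k k' in d1, d2.
    unfold psi, herm.
    set (u1 := fun s : R => phi (act g 0 + RtoC s * (rot g * z))) in *.
    set (u2 := fun s : R => phi (0 + RtoC s * z)) in *.
    set (u3 := fun s : R => Re (tau (0 + RtoC s * z))) in *.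
    set (u4 := fun s : R => Im (tau (0 + RtoC s * z))) in *.
    apply (is_derive_ext (fun s => u1 s - u2 s - (nu - B) * (s * Im (herm z k))
      - mu * (u4 s * Re k' - u3 s * Im k'))%R).
    { intros s. unfold u1, u2, u3, u4, herm, Cmult, Cconj, Re, Im; simpl. ring. }
    clearbody u1 u2 u3 u4.
    auto_derive.
    - repeat split; eexists; eassumption.
    - rewrite (is_derive_unique u1 _ _ d1 : Derive (fun x : R => u1 x) _ = _), (is_derive_unique u2 _ _ d2 : Derive (fun x : R => u2 x) _ = _),
        (is_derive_unique u3 _ _ d3 : Derive (fun x : R => u3 x) _ = _), (is_derive_unique u4 _ _ d4 : Derive (fun x : R => u4 x) _ = _).
      unfold Cddir, herm, Cmult, Cconj, Re, Im; simpl. ring. }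
  assert (E : psi 0%R = psi 1%R).
  { apply (eq_is_derive psi); [intros t _; apply D | lra]. }
  unfold psi in E. rewrite <- !act_line in E.
  replace (0 + RtoC 0 * z) with (RtoC 0) in E by ring.
  replace (0 + RtoC 1 * z) with z in E by ring.
  rewrite Rmult_1_l, Rmult_0_l, Rmult_0_r in E. lra.
Qed.

(** In [phase_cocycle], the z-dependent part of phi(g z) - phi(z) converts [j nu] into [j B] and
    absorbs the [j mu] factor; the remaining constant is the exponent of [chi_tau]. *)
Lemma automorphy_gauge (nu mu : R) (rho : G -> G) (tau : C -> C) (phi : C -> R)
    (chi : G -> C) (g : G) (z : C) :
  equivariant_pair rho tau -> smooth tau -> is_phase nu mu tau phi ->
  cis (phi (act g z)) * (chi g * j nu g z * j mu (rho g) (tau z)) =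
  chi_tau mu rho tau phi chi g * j (B_const nu mu tau) g z * cis (phi z).
Proof.
  intros he ht hphi.
  pose proof (phase_cocycle nu mu rho tau phi g z he ht hphi) as e.
  unfold chi_tau. rewrite <- e. unfold j.
  set (B := B_const nu mu tau). set (I1 := Im (herm z (act (ginv g) 0))).
  set (I2 := Im (herm (tau z) (act (ginv (rho g)) 0))).
  transitivity (chi g * cis (phi (act g z) + - (nu * I1) + - (mu * I2))).
  - rewrite !cis_plus. ring.
  - replace (phi (act g z) + - (nu * I1) + - (mu * I2))%R
      with (phi (act g z) - phi z - (nu - B) * I1 - mu * I2 + - (B * I1) + phi z)%R
      by ring.
    rewrite !cis_plus. ring.
Qed.

Lemma Cmult_cis_cancel (t : R) (a b : C) : cis t * a = cis t * b -> a = b.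
Proof.
  intros h. rewrite <- (Cmult_1_l a), <- (Cmult_1_l b), <- (cis_opp_r t).
  rewrite (Cmult_comm (cis t)), <- !Cmult_assoc. now rewrite h.
Qed.

Lemma W_inverse (phi : C -> R) (f : C -> C) : W phi (W (fun z => (- phi z)%R) f) = f.
Proof.
  apply functional_extensionality; intros z. unfold W.
  rewrite Cmult_assoc, cis_opp_r. apply Cmult_1_l.
Qed.

(** Each condition holds for [f] exactly when its counterpart holds for [W phi f], since the two
    differ by an invertible factor [cis]. The equivalence for a fixed smooth [f] yields both
    inclusions of the set equality. *)
Lemma W_eigen_automorphic (nu mu : R) (rho : G -> G) (tau : C -> C)
    (Gamma : G -> Prop) (chi : G -> C) (lambda : C) (phi : C -> R) (f : C -> C) :
  equivariant_pair rho tau -> smooth tau -> is_phase nu mu tau phi -> smooth f ->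
  (mixed_automorphic nu mu rho tau Gamma chi f /\
   forall z, Delta_mixed nu mu tau f z = lambda * f z) <->
  (automorphic (B_const nu mu tau) Gamma (chi_tau mu rho tau phi chi) (W phi f) /\
   forall z, Delta_B (B_const nu mu tau) (W phi f) z = lambda * W phi f z).
Proof.
  intros he ht hphi hf.
  assert (hW : smooth (W phi f)) by (apply smooth_W; [apply hphi | exact hf]).
  assert (K : forall g z,
    W phi f (act g z) =
      chi_tau mu rho tau phi chi g * j (B_const nu mu tau) g z * W phi f z <->
    f (act g z) = chi g * j nu g z * j mu (rho g) (tau z) * f z).
  { intros g z. unfold W.
    rewrite Cmult_assoc, <- (automorphy_gauge nu mu rho tau phi chi g z he ht hphi),
      <- Cmult_assoc.
    split; [apply Cmult_cis_cancel | intros e; now rewrite e]. }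
  assert (L : forall z,
    Delta_B (B_const nu mu tau) (W phi f) z = lambda * W phi f z <->
    Delta_mixed nu mu tau f z = lambda * f z).
  { intros z. rewrite Delta_gauge by assumption. unfold W.
    replace (lambda * (cis (phi z) * f z)) with (cis (phi z) * (lambda * f z)) by ring.
    split; [apply Cmult_cis_cancel | intros e; now rewrite e]. }
  split; intros [[_ ha] hd].
  - split; [split; [exact hW |] |].
    + intros g z hg. apply K. now apply ha.
    + intros z. apply L, hd.
  - split; [split; [exact hf |] |].
    + intros g z hg. apply K. now apply ha.
    + intros z. apply L, hd.
Qed.

Theorem proposition6p1 :
  forall (nu mu : R) (rho : G -> G) (tau : C -> C) (Gamma : G -> Prop)
         (chi : G -> C) (lambda : C) (phi : C -> R),
  (0 < nu)%R -> (0 < mu)%R ->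
  equivariant_pair rho tau -> smooth tau ->
  is_discrete_subgroup Gamma ->
  (forall g : G, Gamma g -> Gamma (rho g)) ->
  (forall g : G, Gamma g -> Cmod (chi g) = 1%R) ->
  is_phase nu mu tau phi ->
  forall F : C -> C,
    image (W phi)
      (fun f => mixed_automorphic nu mu rho tau Gamma chi f /\
                forall z : C, Delta_mixed nu mu tau f z = Cmult lambda (f z)) F
    <->
    automorphic (B_const nu mu tau) Gamma (chi_tau mu rho tau phi chi) F /\
    forall z : C, Delta_B (B_const nu mu tau) F z = Cmult lambda (F z).
Proof.
  intros nu mu rho tau Gamma chi lambda phi _ _ he ht _ _ _ hphi F. split.
  - intros [f [hf ->]].
    apply (W_eigen_automorphic nu mu rho); auto. apply hf.
  (* The preimage is the product with cis(-phi); it is smooth because [F] is, so the equivalence can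
     be read backwards. *)
  - intros hF. exists (W (fun z => (- phi z)%R) F). split.
    + apply (W_eigen_automorphic nu mu rho tau Gamma chi lambda phi); auto.
      * apply smooth_W; [apply smooth_real_opp, hphi | apply hF].
      * now rewrite W_inverse.
    + symmetry. apply W_inverse.
Qed.
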